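(* Let $A\in\mathbb{R}^{n\times n}$ be Metzler and Hurwitz stable, $b_0\in\mathbb{R}^n_{\ge0}$, and $\mu,\theta>0$ with $r:=\mu/\theta<g_0:=-e_n^TA^{-1}b_0$. Let $g_n:=-e_n^TA^{-1}e_n$ and $u_*:=(g_0-r)/(g_nr)$. Then for all $\eta,k_p>0$ the unique equilibrium $$(x^*,z_1^*,z_2^* )=\Big(-A^{-1}(b_0-ru_*e_n),\ \frac{\mu}{\eta u_*},\ \frac{u_*}{k_p}\Big)$$ of the system $\dot x=Ax-k_px_nz_2e_n+b_0$, $\dot z_1=\mu-k_p\eta z_1z_2$, $\dot z_2=\theta x_n-k_p\eta z_1z_2$ is locally exponentially stable.
   Context: Metzler: all off-diagonal entries nonnegative. Hurwitz stable: all eigenvalues have negative real part. $e_i$: standard basis vectors of $\mathbb{R}^n$; $x_n=e_n^Tx$. An equilibrium is called locally exponentially stable here if the Jacobian matrix of the vector field at the equilibrium is Hurwitz stable. *)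

(* Defs.v *)
From HB Require Import structures.
From mathcomp Require Import all_boot all_order all_algebra.
From mathcomp Require Import all_classical all_reals all_analysis.
From mathcomp Require Import complex.
Set Implicit Arguments.
Unset Strict Implicit.
Unset Printing Implicit Defensive.
Import Order.TTheory GRing.Theory Num.Theory.
Local Open Scope ring_scope.

Definition metzler (R : realType) (m : nat) (A : 'M[R]_m) : Prop :=
  forall i j : 'I_m, i != j -> 0 <= A i j.

Definition hurwitz (R : realType) (m : nat) (A : 'M[R]_m) : Prop :=
  forall l : R[i],
    eigenvalue (map_mx (fun a : R => (a%:C)%C) A) l -> complex.Re l < 0.

(* The state of the closed loop system is s = (x, z1, z2), a row vector of
   size (n+1) + 2 (here the paper's dimension is n.+1, so e_n is ord_max). *)
Section System.
Variables (R : realType) (n : nat).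
Variables (A : 'M[R]_n.+1) (b0 : 'cV[R]_n.+1) (mu theta eta kp : R).

Definition en : 'cV[R]_n.+1 := delta_mx ord_max 0.

Definition st_x (s : 'rV[R]_(n.+1 + 2)) : 'cV[R]_n.+1 := (lsubmx s)^T.
Definition st_z1 (s : 'rV[R]_(n.+1 + 2)) : R := rsubmx s 0 0.
Definition st_z2 (s : 'rV[R]_(n.+1 + 2)) : R := rsubmx s 0 1.

Definition mk_state (x : 'cV[R]_n.+1) (z1 z2 : R) : 'rV[R]_(n.+1 + 2) :=
  row_mx x^T (\row_(j < 2) if j == 0 then z1 else z2).

Definition vfield (s : 'rV[R]_(n.+1 + 2)) : 'rV[R]_(n.+1 + 2) :=
  let x := st_x s in let z1 := st_z1 s in let z2 := st_z2 s in
  let xn := x ord_max 0 in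
  mk_state (A *m x - (kp * xn * z2) *: en + b0)
           (mu - kp * eta * z1 * z2)
           (theta * xn - kp * eta * z1 * z2).

Definition g0 : R := - (invmx A *m b0) ord_max 0.
Definition gn : R := - (invmx A *m en) ord_max 0.
Definition rr : R := mu / theta.
Definition ustar : R := (g0 - rr) / (gn * rr).

Definition equil : 'rV[R]_(n.+1 + 2) :=
  mk_state (- (invmx A *m (b0 - (rr * ustar) *: en)))
           (mu / (eta * ustar)) (ustar / kp).

End System.

(* Main.v *)
(** An eigenvector of the Jacobian for [l] with [0 <= Re l] consists of [xi],
    [z1], [z2] satisfying, with [u := ustar], [a := eta * u], [c := kp * mu / u],
      [l xi = A xi - (u xi_n + kp r z2) e_n],  [l z1 = - (a z1 + c z2)],
      [l z2 = theta xi_n - (a z1 + c z2)].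
    A Hurwitz Metzler matrix [A] has positive vectors [p], [q] with [A p < 0] and
    [q^T A < 0], so [diag (q / p)] is a diagonal Lyapunov function for [A]. Hence
    the first equation is passive: [kp r Re (conj xi_n z2) <= - u |xi_n|^2]. The
    other two give [theta Re (conj xi_n z2) >= 0], whatever [a, c > 0] are.
    So [xi_n = 0], and then [xi], [z1], [z2] all vanish. *)

Require Import Defs.
From HB Require Import structures.
From mathcomp Require Import all_boot all_order all_algebra.
From mathcomp Require Import all_classical all_reals all_analysis.
From mathcomp Require Import complex.
From mathcomp Require Import ring lra.
Set Implicit Arguments.
Unset Strict Implicit.
Unset Printing Implicit Defensive.
Import Order.TTheory GRing.Theory Num.Theory.
Import numFieldNormedType.Exports.
Local Open Scope ring_scope.

Lemma metzler_mulmx_ge0 (R : realType) (m : nat) (A : 'M[R]_m) (v : 'cV[R]_m)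
    (i : 'I_m) :
  metzler A -> (forall j, 0 <= v j 0) -> v i 0 = 0 -> 0 <= (A *m v) i 0.
Proof.
move=> mA v0 vi; rewrite mxE; apply: sumr_ge0 => j _.
have [<-|ij] := eqVneq i j; first by rewrite vi mulr0.
by apply: mulr_ge0 => //; exact: mA.
Qed.

Lemma metzler_pos (R : realType) (m : nat) (A : 'M[R]_m) (v : 'cV[R]_m) :
  metzler A -> (forall j, 0 <= v j 0) -> (forall i, (A *m v) i 0 < 0) ->
  forall i, 0 < v i 0.
Proof.
move=> mA v0 Av i; rewrite lt_def v0 andbT; apply/eqP => vi.
by have := Av i; rewrite ltNge metzler_mulmx_ge0.
Qed.

(* Comparison at the index where [v i / p i] is smallest. *)
Lemma metzler_monotone (R : realType) (m : nat) (A : 'M[R]_m) (p v : 'cV[R]_m) :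
  metzler A -> (forall i, 0 < p i 0) -> (forall i, (A *m p) i 0 < 0) ->
  (forall i, (A *m v) i 0 <= 0) -> forall i, 0 <= v i 0.
Proof.
move=> mA p0 Ap Av k; rewrite leNgt; apply/negP => vk.
have [i _ imin] := @arg_minP _ _ _ k xpredT (fun i => v i 0 / p i 0) isT.
set c := v i 0 / p i 0 in imin.
have c0 : c < 0.
  by apply: le_lt_trans (imin k isT) _; rewrite pmulr_llt0 // invr_gt0.
have w0 j : 0 <= (v - c *: p) j 0.
  by rewrite !mxE subr_ge0 -ler_pdivlMr //; exact: imin.
have wi : (v - c *: p) i 0 = 0 by rewrite !mxE /c divfK ?subrr // gt_eqF.
have := @metzler_mulmx_ge0 _ _ _ _ _ mA w0 wi.
rewrite mulmxBr -scalemxAr !mxE; have := Av i; have := Ap i.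
by rewrite !mxE => h1 h2 h3; nra.
Qed.

Lemma horner_char_poly_mx (R : comNzRingType) (m : nat) (A : 'M[R]_m) (t : R) :
  map_mx (horner_eval t) (char_poly_mx A) = t%:M - A.
Proof.
rewrite /char_poly_mx map_mxB map_scalar_mx /= horner_evalE hornerX.
by congr (_ - _); apply/matrixP => i j; rewrite !mxE horner_evalE hornerC.
Qed.

Lemma hurwitz_det_neq0 (R : realType) (m : nat) (A : 'M[R]_m) (t : R) :
  hurwitz A -> 0 <= t -> \det (t%:M - A) != 0.
Proof.
move=> hA t0; apply/negP => /eqP dt.
have : eigenvalue A t.
  rewrite eigenvalue_root_char /root -[char_poly A]/(\det (char_poly_mx A)).
  have -> : (\det (char_poly_mx A)).[t] = \det (t%:M - A).
    rewrite -[LHS]/(horner_eval t _) -det_map_mx; congr (\det _).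
    exact: horner_char_poly_mx.
  by rewrite dt.
move=> et; have := hA t%:C%C.
rewrite (@eigenvalue_map _ _ (real_complex R) _ A t) => /(_ et) /=.
by rewrite ltNge t0.
Qed.

(* [t |-> det (tI - A) * adj (tI - A) * 1] is polynomial in [t] and has the sign
   of the resolvent [(tI - A)^-1 * 1]. It is positive for large [t], and the
   last [t >= 0] at which a coordinate fails to be positive would contradict
   [metzler_pos]. *)
Lemma hurwitz_metzler_pos (R : realType) (m : nat) (A : 'M[R]_m) :
  metzler A -> hurwitz A ->
  exists2 p : 'cV[R]_m, (forall i, 0 < p i 0) & (forall i, (A *m p) i 0 < 0).
Proof.
move=> mA hA.
pose B t : 'M[R]_m := t%:M - A.
pose P : 'cV[{poly R}]_m :=
  \det (char_poly_mx A) *: (\adj (char_poly_mx A) *m const_mx 1).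
pose v t : 'cV[R]_m := map_mx (horner_eval t) P.
have BE t : map_mx (horner_eval t) (char_poly_mx A) = B t.
  exact: horner_char_poly_mx.
have Bv t : B t *m v t = const_mx (\det (B t) ^+ 2).
  rewrite /v map_mxZ map_mxM map_mx_adj BE -det_map_mx BE -scalemxAr mulmxA.
  rewrite mul_mx_adj mul_scalar_mx scalerA -expr2; apply/matrixP => i j.
  by rewrite !mxE rmorph1 mulr1.
have mB t : metzler (- B t).
  by move=> i j ij; rewrite !mxE (negPf ij) mulr0n sub0r opprK mA.
have Bv0 t : 0 <= t -> forall i, (- B t *m v t) i 0 < 0.
  move=> t0 i; rewrite mulNmx Bv !mxE oppr_lt0 exprn_even_gt0 //=.
  exact: hurwitz_det_neq0.
have v_cont i : continuous (fun t => v t i 0).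
  move=> t; rewrite (_ : (fun t => _) = horner (P i 0)); first exact: continuous_horner.
  by apply/funext => s; rewrite mxE.
pose T := \sum_i \sum_j `|A i j|.
have vT t : T < t -> forall i, 0 < v t i 0.
  move=> Tt; have t0 : 0 <= t.
    by apply: le_trans (ltW Tt); apply: sumr_ge0 => i _; apply: sumr_ge0.
  apply: (metzler_pos (mB t)) (Bv0 t t0).
  apply: (metzler_monotone (p := const_mx 1) (mB t)) => [i|i|i].
  - by rewrite mxE.
  - rewrite mulNmx mulmxBl mul_scalar_mx !mxE mulr1 oppr_lt0 subr_gt0.
    apply: le_lt_trans Tt; rewrite /T [leRHS](bigD1 i) //=.
    apply: (@le_trans _ _ (\sum_j `|A i j|)).
      by apply: ler_sum => j _; rewrite mxE mulr1 ler_norm.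
    by rewrite lerDl; apply: sumr_ge0 => k _; apply: sumr_ge0.
  - exact/ltW/Bv0.
suff v0 : forall i, 0 < v 0 i 0.
  exists (v 0) => // i; have := Bv0 0 (lexx _) i.
  by rewrite /B raddf0 sub0r opprK.
pose S : set R := [set t | 0 <= t /\ exists i, v t i 0 <= 0]%classic.
apply: contrapT => /existsNP [i0 /negP]; rewrite -leNgt => vi0.
have S0 : S 0 by split => //; exists i0.
have Sub : has_ubound S.
  exists T => t [t0 [i vi]]; rewrite leNgt; apply/negP => /vT /(_ i).
  by rewrite ltNge vi.
have Ssup : has_sup S by split; first by exists 0.
set s := sup S.
have s0 : 0 <= s by exact: ub_le_sup.
have v_ge0 i : 0 <= v s i 0.
  rewrite leNgt; apply/negP => vi.
  have /nbhs_ballP [e /= e0 He] : \forall t \near s, v t i 0 < 0.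
    exact: (cvgr_lt _ (v_cont i s) 0 vi).
  have /He vse : ball s e (s + e / 2).
    by rewrite /ball /= opprD addrA subrr sub0r normrN gtr0_norm; lra.
  have : S (s + e / 2) by split; [lra | exists i; exact: ltW].
  by move/(ub_le_sup Sub); rewrite -/s; lra.
have v_gt0 := metzler_pos (mB s) v_ge0 (Bv0 s s0).
have /nbhs_ballP [e /= e0 He] : \forall t \near s, forall i, 0 < v t i 0.
  apply: (@filter_forall _ _ (fun i t => is_true (0 < v t i 0)) _ (nbhs_filter s)) => i.
  exact: (cvgr_gt _ (v_cont i s) 0 (v_gt0 i)).
have [t [t0 [i vi]] st] := sup_adherent e0 Ssup.
have ts : t <= s by apply: ub_le_sup => //; split => //; exists i.
have /He /(_ i) : ball s e t.
  by rewrite /ball /= ger0_norm ?subr_ge0 //; rewrite -/s in st; lra.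
by rewrite ltNge vi.
Qed.

Lemma char_poly_tr (R : comNzRingType) (m : nat) (A : 'M[R]_m) :
  char_poly A^T = char_poly A.
Proof.
rewrite /char_poly -[RHS]det_tr; congr (\det _).
by rewrite /char_poly_mx linearB /= tr_scalar_mx map_trmx.
Qed.

Lemma hurwitz_tr (R : realType) (m : nat) (A : 'M[R]_m) :
  hurwitz A -> hurwitz A^T.
Proof.
by move=> hA l; rewrite -map_trmx eigenvalue_root_char char_poly_tr
  -eigenvalue_root_char; exact: hA.
Qed.

Lemma metzler_tr (R : realType) (m : nat) (A : 'M[R]_m) :
  metzler A -> metzler A^T.
Proof. by move=> mA i j ij; rewrite mxE mA // eq_sym. Qed.

Lemma hurwitz_unitmx (R : realType) (m : nat) (A : 'M[R]_m) :
  hurwitz A -> A \in unitmx.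
Proof.
move=> /hurwitz_det_neq0 /(_ (lexx 0)); rewrite raddf0 sub0r -scaleN1r detZ.
by rewrite mulf_eq0 negb_or unitmxE unitfE => /andP[].
Qed.

Lemma gn_gt0 (R : realType) (n : nat) (A : 'M[R]_n.+1) :
  metzler A -> hurwitz A -> 0 < gn A.
Proof.
move=> mA hA; have uA := hurwitz_unitmx hA.
have [p p0 Ap] := hurwitz_metzler_pos mA hA.
pose v := - (invmx A *m en R n).
have Av : A *m v = - en R n by rewrite mulmxN mulKVmx.
have v0 : forall i, 0 <= v i 0.
  apply: (metzler_monotone mA p0 Ap) => i.
  by rewrite Av !mxE oppr_le0 andbT ler0n.
have -> : gn A = v ord_max 0 by rewrite /v [RHS]mxE.
rewrite lt_def v0 andbT; apply/eqP => vn.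
have := metzler_mulmx_ge0 mA v0 vn.
by rewrite Av !mxE !eqxx /= oppr_ge0 ler10.
Qed.

(* The diagonal Lyapunov function with weights [q i / p i]: the matrix with
   entries [q i * A i j * p j] has nonpositive row and column sums. *)
Lemma metzler_diag_lyapunov (R : realType) (m : nat) (A : 'M[R]_m)
    (p q : 'cV[R]_m) (x : 'I_m -> R) :
  metzler A -> (forall i, 0 < p i 0) -> (forall i, 0 < q i 0) ->
  (forall i, (A *m p) i 0 < 0) -> (forall i, (A^T *m q) i 0 < 0) ->
  \sum_i q i 0 / p i 0 * x i * \sum_j A i j * x j <= 0.
Proof.
move=> mA p0 q0 Ap Aq.
pose y i := x i / p i 0.
pose M i j := q i 0 * A i j * p j 0 / 2.
apply: (@le_trans _ _ (\sum_i \sum_j (M i j * y i ^+ 2 + M i j * y j ^+ 2))).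
  apply: ler_sum => i _; rewrite mulr_sumr; apply: ler_sum => j _.
  have -> : q i 0 / p i 0 * x i * (A i j * x j) = M i j * (2 * (y i * y j)).
    by rewrite /M /y; field; rewrite !gt_eqF.
  rewrite -mulrDr; have [->|ij] := eqVneq i j; first by rewrite -mulr2n mulr_natl -expr2.
  apply: ler_wpM2l; last by have := sqr_ge0 (y i - y j); rewrite sqrrB; lra.
  by rewrite /M divr_ge0 // mulr_ge0 ?(ltW (p0 _)) // mulr_ge0 ?(ltW (q0 _)) // mA.
have My_le0 i : \sum_j M i j * y i ^+ 2 <= 0.
  have -> : \sum_j M i j * y i ^+ 2 = q i 0 * y i ^+ 2 / 2 * (A *m p) i 0.
    by rewrite mxE mulr_sumr; apply: eq_bigr => j _; rewrite /M; ring.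
  apply: mulr_ge0_le0; last exact: ltW.
  by rewrite divr_ge0 // mulr_ge0 ?sqr_ge0 // ltW.
have yM_le0 j : \sum_i M i j * y j ^+ 2 <= 0.
  have -> : \sum_i M i j * y j ^+ 2 = p j 0 * y j ^+ 2 / 2 * (A^T *m q) j 0.
    by rewrite mxE mulr_sumr; apply: eq_bigr => i _; rewrite /M mxE; ring.
  apply: mulr_ge0_le0; last exact: ltW.
  by rewrite divr_ge0 // mulr_ge0 ?sqr_ge0 // ltW.
under eq_bigr do rewrite big_split /=.
rewrite big_split /= [X in _ + X]exchange_big /= -[leRHS]addr0.
by apply: lerD; apply: sumr_le0.
Qed.

Section diff_row.
Variables (R : realType) (V W : normedModType R).

Lemma is_diff_sum (n : nat) (f df : 'I_n -> V -> W) (p : V) :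
  (forall i, is_diff p (f i) (df i)) ->
  is_diff p (\sum_i f i) (\sum_i df i).
Proof.
move=> h; elim/big_ind2 : _ => //; first exact: (is_diff_cst 0).
by move=> f1 df1 f2 df2 h1 h2; exact: is_diffD.
Qed.

Lemma is_diffZl (k dk : V -> R) (w : W) (p : V) :
  is_diff p k dk -> is_diff p (fun s => k s *: w) (fun s => dk s *: w).
Proof.
move=> hk; apply: DiffDef; first exact/differentiableZl.
by rewrite diffZl // diff_val.
Qed.

End diff_row.

Lemma is_diff_coord (R : realType) (m n : nat) (M : 'M[R]_(m, n)) i j :
  is_diff M (fun N : 'M[R]_(m, n) => N i j : R) (fun N => N i j).
Proof.
apply: DiffDef; first exact: differentiable_coord.
have lin_c : linear (fun N : 'M[R]_(m, n) => N i j : R^o).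
  by move=> a u v; rewrite !mxE.
pose cM := GRing.isLinear.Build _ _ _ _ _ lin_c.
pose c : {linear 'M[R]_(m, n) -> R^o} := HB.pack (fun N : 'M[R]_(m, n) => N i j) cM.
exact: (@diff_lin _ _ _ c M (@coord_continuous _ _ _ i j)).
Qed.

Lemma is_diff_row (R : realType) (V : normedModType R) (n : nat)
    (f : V -> 'rV[R]_n) (df : 'I_n -> V -> R) (p : V) :
  (forall j, is_diff p (fun s => f s 0 j) (df j)) ->
  is_diff p f (fun v => \row_j df j v).
Proof.
move=> h.
have -> : f = \sum_j (fun s => f s 0 j *: delta_mx 0 j).
  by apply/funext => s; rewrite fct_sumE {1}[f s]row_sum_delta.
apply: is_diff_eq; first by apply: is_diff_sum => j; exact: is_diffZl.
apply/funext => v; rewrite fct_sumE [RHS]row_sum_delta.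
by apply: eq_bigr => j _; rewrite mxE.
Qed.

Section closed_loop.
Variables (R : realType) (n : nat).
Variables (A : 'M[R]_n.+1) (b0 : 'cV[R]_n.+1) (mu theta eta kp : R).
Local Notation F := (vfield A b0 mu theta eta kp).
Implicit Types (s v : 'rV[R]_(n.+1 + 2)).

Lemma st_x_mk (x : 'cV[R]_n.+1) z1 z2 : st_x (mk_state x z1 z2) = x.
Proof. by rewrite /st_x row_mxKl trmxK. Qed.

Lemma st_z1_mk (x : 'cV[R]_n.+1) z1 z2 : st_z1 (mk_state x z1 z2) = z1.
Proof. by rewrite /st_z1 row_mxKr mxE. Qed.

Lemma st_z2_mk (x : 'cV[R]_n.+1) z1 z2 : st_z2 (mk_state x z1 z2) = z2.
Proof. by rewrite /st_z2 row_mxKr mxE. Qed.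

Lemma st_x_eq0 : @st_x R n 0 = 0.
Proof. by rewrite /st_x linear0 trmx0. Qed.

Lemma st_z1_eq0 : @st_z1 R n 0 = 0.
Proof. by rewrite /st_z1 !mxE. Qed.

Lemma st_z2_eq0 : @st_z2 R n 0 = 0.
Proof. by rewrite /st_z2 !mxE. Qed.

Lemma state_eqP s v :
  [/\ st_x s = st_x v, st_z1 s = st_z1 v & st_z2 s = st_z2 v] -> s = v.
Proof.
rewrite /st_x /st_z1 /st_z2 => -[/trmx_inj hx h1 h2].
rewrite -[s]hsubmxK -[v]hsubmxK hx; congr row_mx; apply/rowP => j.
have [->|->] // : j = 0 \/ j = 1.
by case: j => [[|[|//]] ?]; [left | right]; exact: val_inj.
Qed.

Definition vfield_diff s v : 'rV[R]_(n.+1 + 2) :=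
  let dxz := kp * (st_x v ord_max 0 * st_z2 s + st_x s ord_max 0 * st_z2 v) in
  let dzz := kp * eta * (st_z1 v * st_z2 s + st_z1 s * st_z2 v) in
  mk_state (A *m st_x v - dxz *: en R n) (- dzz)
           (theta * st_x v ord_max 0 - dzz).

Lemma vfield_jacobian s v : v *m 'J F s = vfield_diff s v.
Proof.
pose c j : 'rV[R]_(n.+1 + 2) -> R := fun s => s 0 j.
pose z1 := c (rshift n.+1 0); pose z2 := c (rshift n.+1 1).
pose xn := c (lshift 2 ord_max).
have dc j : is_diff s (c j) (c j) by exact: is_diff_coord.
pose G (j : 'I_(n.+1 + 2)) : 'rV[R]_(n.+1 + 2) -> R :=
  match fintype.split j with
  | inl i => \sum_k (A i k *: c (lshift 2 k)) - (kp * (i == ord_max)%:R) *: (xn * z2)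
      + cst (b0 i 0)
  | inr i => (i != 0)%:R *: (theta *: xn) - (kp * eta) *: (z1 * z2)
      + cst ((i == 0)%:R * mu)
  end.
pose dG (j : 'I_(n.+1 + 2)) : 'rV[R]_(n.+1 + 2) -> R :=
  match fintype.split j with
  | inl i => \sum_k (A i k *: c (lshift 2 k)) - (kp * (i == ord_max)%:R)
      *: (xn s *: z2 + z2 s *: xn) + 0
  | inr i => (i != 0)%:R *: (theta *: xn) - (kp * eta)
      *: (z1 s *: z2 + z2 s *: z1) + 0
  end.
have AE t i : \sum_j A i j * st_x t j 0 = (\sum_k A i k *: c (lshift 2 k)) t.
  by rewrite fct_sumE; apply: eq_bigr => k _; rewrite !mxE.
have xnE t : st_x t ord_max 0 = xn t by rewrite !mxE.
have z1E t : st_z1 t = z1 t by rewrite /st_z1 mxE.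
have z2E t : st_z2 t = z2 t by rewrite /st_z2 mxE.
have dGP j : is_diff s (G j) (dG j).
  rewrite /G /dG; case: fintype.split => i; last exact: is_diffD.
  by apply: is_diffD; apply: is_diffB; apply: is_diff_sum => k; exact: is_diffZ.
have dF : is_diff s F (fun v => \row_j dG j v).
  apply: is_diff_row => j; rewrite (_ : (fun _ => _) = G j) //.
  apply/funext => t; rewrite /G /vfield xnE z1E z2E /mk_state mxE.
  case: fintype.split => i; first by rewrite !mxE AE eqxx andbT !fctE /GRing.scale /=; ring.
  by rewrite mxE !fctE /GRing.scale /=; case: eqP => _ /=; ring.
rewrite /jacobian mul_rV_lin1 /= diff_val.
apply/rowP => j; rewrite /dG /vfield_diff !xnE !z1E !z2E /mk_state 2!mxE.
case: fintype.split => i; rewrite addr0.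
  by rewrite !mxE AE eqxx andbT !fctE /GRing.scale /=; ring.
by rewrite mxE !fctE /GRing.scale /=; case: eqP => _ /=; ring.
Qed.

End closed_loop.

Definition complex_row (R : realType) (m : nat) (x y : 'rV[R]_m) : 'rV[R[i]]_m :=
  \row_j (x 0 j +i* y 0 j)%C.

Lemma complex_row_inj (R : realType) (m : nat) (x y x' y' : 'rV[R]_m) :
  complex_row x y = complex_row x' y' -> x = x' /\ y = y'.
Proof.
by move=> /rowP h; split; apply/rowP => j; have := h j; rewrite !mxE => -[].
Qed.

Lemma complex_row_surj (R : realType) (m : nat) (v : 'rV[R[i]]_m) :
  exists x y, v = complex_row x y.
Proof.
exists (map_mx (@complex.Re R) v), (map_mx (@complex.Im R) v).
by apply/rowP => j; rewrite !mxE; case: (v 0 j).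
Qed.

Lemma complex_row_mul (R : realType) (m : nat) (A : 'M[R]_m) (x y : 'rV[R]_m) :
  complex_row x y *m map_mx (fun a : R => (a%:C)%C) A =
  complex_row (x *m A) (y *m A).
Proof.
apply/rowP => j; rewrite !mxE; elim/big_rec3 : _ => // k a b c _ ->.
by rewrite !mxE; simpc.
Qed.

Lemma complex_row_scale (R : realType) (m : nat) (a b : R) (x y : 'rV[R]_m) :
  (a +i* b)%C *: complex_row x y =
  complex_row (a *: x - b *: y) (a *: y + b *: x).
Proof. by apply/rowP => j; rewrite !mxE; simpc. Qed.

Lemma hurwitzP (R : realType) (m : nat) (A : 'M[R]_m) :
  hurwitz A <->
  forall (a b : R) (x y : 'rV[R]_m), 0 <= a ->
    x *m A = a *: x - b *: y -> y *m A = a *: y + b *: x -> x = 0 /\ y = 0.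
Proof.
have row0 : complex_row 0 0 = 0 :> 'rV[R[i]]_m by apply/rowP => j; rewrite !mxE.
split=> [hA a b x y a0 hx hy|hA [a b] /eigenvalueP [v]].
  apply: complex_row_inj; rewrite row0; apply/eqP; apply: contraLR a0 => v0.
  rewrite -ltNge; apply: (hA (a +i* b)%C); apply/eigenvalueP.
  by exists (complex_row x y); rewrite // complex_row_mul complex_row_scale hx hy.
have [x [y ->]] := complex_row_surj v.
rewrite complex_row_mul complex_row_scale => /complex_row_inj [hx hy] v0 /=.
rewrite ltNge; apply: contraNN v0 => a0.
by have [-> ->] := hA a b x y a0 hx hy; rewrite row0.
Qed.

Section spectrum.
Variables (R : realType) (n : nat) (A : 'M[R]_n.+1).
Hypotheses (mA : metzler A) (hA : hurwitz A).

Lemma metzler_passive (al be wx wy : R) (x y : 'cV[R]_n.+1) : 0 <= al ->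
  A *m x + wx *: en R n = al *: x - be *: y ->
  A *m y + wy *: en R n = al *: y + be *: x ->
  0 <= x ord_max 0 * wx + y ord_max 0 * wy.
Proof.
move=> al0 hx hy.
have [p p0 Ap] := hurwitz_metzler_pos mA hA.
have [q q0 Aq] := hurwitz_metzler_pos (metzler_tr mA) (hurwitz_tr hA).
pose d i := q i 0 / p i 0.
have d0 i : 0 < d i by exact: divr_gt0.
have xE i : \sum_j A i j * x j 0 = al * x i 0 - be * y i 0 - wx * (i == ord_max)%:R.
  move/colP: hx => /(_ i); rewrite !mxE eqxx andbT => <-; ring.
have yE i : \sum_j A i j * y j 0 = al * y i 0 + be * x i 0 - wy * (i == ord_max)%:R.
  move/colP: hy => /(_ i); rewrite !mxE eqxx andbT => <-; ring.
have Qx := metzler_diag_lyapunov (fun i => x i 0) mA p0 q0 Ap Aq.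
have Qy := metzler_diag_lyapunov (fun i => y i 0) mA p0 q0 Ap Aq.
have := lerD Qx Qy; rewrite -big_split addr0 /=.
under eq_bigr do rewrite xE yE.
have -> : \sum_i (q i 0 / p i 0 * x i 0 *
        (al * x i 0 - be * y i 0 - wx * (i == ord_max)%:R) +
      q i 0 / p i 0 * y i 0 *
        (al * y i 0 + be * x i 0 - wy * (i == ord_max)%:R)) =
  \sum_i d i * al * (x i 0 ^+ 2 + y i 0 ^+ 2) -
  \sum_i (if i == ord_max then d i * (x i 0 * wx + y i 0 * wy) else 0).
  rewrite -sumrB; apply: eq_bigr => i _; rewrite /d.
  by case: eqP => _ /=; ring.
rewrite -big_mkcond big_pred1_eq /= => h.
rewrite -(pmulr_rge0 _ (d0 ord_max)).
apply: le_trans (_ : \sum_i d i * al * (x i 0 ^+ 2 + y i 0 ^+ 2) <= _); last lra.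
apply: sumr_ge0 => i _; apply: mulr_ge0; last by rewrite addr_ge0 ?sqr_ge0.
by rewrite mulr_ge0 // ltW.
Qed.

Lemma closed_loop_spectrum (al be a c u k theta : R) (x y : 'cV[R]_n.+1)
    (x1 y1 x2 y2 : R) :
  0 <= al -> 0 < a -> 0 < c -> 0 < u -> 0 < k -> 0 < theta ->
  A *m x - (u * x ord_max 0 + k * x2) *: en R n = al *: x - be *: y ->
  A *m y - (u * y ord_max 0 + k * y2) *: en R n = al *: y + be *: x ->
  - (a * x1 + c * x2) = al * x1 - be * y1 ->
  - (a * y1 + c * y2) = al * y1 + be * x1 ->
  theta * x ord_max 0 - (a * x1 + c * x2) = al * x2 - be * y2 ->
  theta * y ord_max 0 - (a * y1 + c * y2) = al * y2 + be * x2 ->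
  [/\ x = 0, y = 0, x1 = 0 /\ y1 = 0 & x2 = 0 /\ y2 = 0].
Proof.
move=> al0 a0 c0 u0 k0 th0 hx hy h1x h1y h2x h2y.
have := @metzler_passive al be (- (u * x ord_max 0 + k * x2))
  (- (u * y ord_max 0 + k * y2)) x y al0.
rewrite !scaleNr => /(_ hx hy).
set xn := x ord_max 0 in hx h2x *; set yn := y ord_max 0 in hy h2y * => hP.
have cx2 : c * x2 = - (al + a) * x1 + be * y1 by lra.
have cy2 : c * y2 = - (al + a) * y1 - be * x1 by lra.
have hN : 0 <= xn * x2 + yn * y2.
  rewrite -(pmulr_rge0 _ c0) -(pmulr_rge0 _ th0).
  have -> : theta * (c * (xn * x2 + yn * y2)) =
      c * al * (x2 ^+ 2 + y2 ^+ 2) + (al * (al + a) + be ^+ 2) * (x1 ^+ 2 + y1 ^+ 2).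
    have -> : theta * (c * (xn * x2 + yn * y2)) =
      (theta * xn) * (c * x2) + (theta * yn) * (c * y2) by ring.
    have -> : theta * xn = al * x2 - be * y2 + (a * x1 + c * x2) by lra.
    have -> : theta * yn = al * y2 + be * x2 + (a * y1 + c * y2) by lra.
    rewrite [LHS](_ : _ = c * al * (x2 ^+ 2 + y2 ^+ 2) +
      (a * x1 + c * x2) * (c * x2) + (a * y1 + c * y2) * (c * y2)); last ring.
    by rewrite cx2 cy2; ring.
  have sq_ge0 (z w : R) : 0 <= z ^+ 2 + w ^+ 2 by rewrite addr_ge0 ?sqr_ge0.
  apply: addr_ge0; apply: mulr_ge0 => //; first by rewrite mulr_ge0 // ltW.
  by rewrite addr_ge0 ?sqr_ge0 // mulr_ge0 // addr_ge0 // ltW.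
have hk := mulr_ge0 (ltW k0) hN.
have hu : u * (xn ^+ 2 + yn ^+ 2) <= 0 by lra.
have {hu}hxy : xn ^+ 2 + yn ^+ 2 == 0.
  by rewrite eq_le addr_ge0 ?sqr_ge0 // andbT -(pmulr_rle0 _ u0).
have [xn0 yn0] : xn = 0 /\ yn = 0.
  by move: hxy; rewrite paddr_eq0 ?sqr_ge0 // !sqrf_eq0 => /andP[/eqP ? /eqP ?].
rewrite xn0 yn0 !mulr0 !add0r in hx hy h2x h2y.
have [[x20 y20] [x10 y10]] : (x2 = 0 /\ y2 = 0) /\ (x1 = 0 /\ y1 = 0).
  have [/eqP|ab0] := eqVneq (al ^+ 2 + be ^+ 2) 0.
    rewrite paddr_eq0 ?sqr_ge0 // !sqrf_eq0 => /andP[/eqP al_0 /eqP be_0].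
    rewrite al_0 be_0 !scale0r ?subr0 ?addr0 in hx hy; rewrite al_0 be_0 in cx2 cy2.
    have gz z w : A *m z - (k * w) *: en R n = 0 -> z ord_max 0 = 0 -> w = 0.
      move=> /eqP; rewrite subr_eq0 => /eqP hz z0.
      have := congr1 (mulmx (invmx A)) hz.
      rewrite mulKmx ?hurwitz_unitmx // -scalemxAr => /colP /(_ ord_max).
      rewrite z0 mxE => /esym /eqP; rewrite mulf_eq0 mulf_eq0 gt_eqF //=.
      by case/orP => /eqP // /(congr1 -%R); rewrite -/(gn A) oppr0 => gn0;
        have := gn_gt0 mA hA; rewrite gn0 ltxx.
    have x20 := gz _ _ hx xn0; have y20 := gz _ _ hy yn0.
    rewrite x20 y20 in cx2 cy2 *; split => //.
    by split; apply: (mulfI (lt0r_neq0 a0)); lra.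
  have e1 : al * (x2 - x1) = be * (y2 - y1) by lra.
  have e2 : al * (y2 - y1) = - be * (x2 - x1) by lra.
  have x21 : x2 - x1 = 0.
    apply: (mulfI ab0); rewrite mulr0.
    have -> : (al ^+ 2 + be ^+ 2) * (x2 - x1) =
      al * (al * (x2 - x1)) - be * (- be * (x2 - x1)) by ring.
    by rewrite e1 -e2; ring.
  have y21 : y2 - y1 = 0.
    apply: (mulfI ab0); rewrite mulr0.
    have -> : (al ^+ 2 + be ^+ 2) * (y2 - y1) =
      al * (al * (y2 - y1)) + be * (be * (y2 - y1)) by ring.
    by rewrite e2 -e1; ring.
  have f1 : (al + a + c) * x1 = be * y1 by nra.
  have f2 : (al + a + c) * y1 = - be * x1 by nra.
  have s0 : 0 < al + a + c by lra.
  have : (al + a + c) * (x1 ^+ 2 + y1 ^+ 2) = 0.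
    rewrite [LHS](_ : _ = x1 * ((al + a + c) * x1) + y1 * ((al + a + c) * y1)); last ring.
    by rewrite f1 f2; ring.
  move/eqP; rewrite mulf_eq0 gt_eqF //= paddr_eq0 ?sqr_ge0 // !sqrf_eq0.
  by move=> /andP[/eqP x10 /eqP y10]; rewrite x10 y10 !subr0 in x21 y21 *.
rewrite x20 y20 mulr0 scale0r !subr0 in hx hy.
have [] := (hurwitzP A^T).1 (hurwitz_tr hA) al be x^T y^T al0.
- by rewrite -trmx_mul hx linearB /= !linearZ.
- by rewrite -trmx_mul hy linearD /= !linearZ.
by move=> /(congr1 trmx) + /(congr1 trmx); rewrite !trmxK !trmx0.
Qed.

End spectrum.

Lemma equil_xn (R : realType) (n : nat) (A : 'M[R]_n.+1) (b0 : 'cV[R]_n.+1)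
    (r w : R) :
  (- (invmx A *m (b0 - (r * w) *: en R n))) ord_max 0 = g0 A b0 - gn A * r * w.
Proof.
rewrite mulmxBr -scalemxAr /g0 /gn.
by move: (invmx A *m b0) (invmx A *m en R n) => P Q; rewrite !mxE; ring.
Qed.

Theorem mainTheorem9 (R : realType) (n : nat) (A : 'M[R]_n.+1)
  (b0 : 'cV[R]_n.+1) (mu theta : R) :
  metzler A -> hurwitz A ->
  (forall i, 0 <= b0 i 0) ->
  0 < mu -> 0 < theta ->
  mu / theta < g0 A b0 ->
  forall eta kp : R, 0 < eta -> 0 < kp ->
    let F := vfield A b0 mu theta eta kp in
    let s := equil A b0 mu theta eta kp in
    [/\ F s = 0,
        (forall s' : 'rV[R]_(n.+1 + 2), F s' = 0 -> s' = s)
      & hurwitz ('J F s)].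
Proof.
move=> mA hA _ mu0 th0 rg0 eta kp eta0 kp0 F s.
have uA := hurwitz_unitmx hA; have gn0 := gn_gt0 mA hA.
set r := mu / theta in rg0.
have r0 : 0 < r by exact: divr_gt0.
have mur : mu = theta * r by rewrite /r mulrC divfK // gt_eqF.
set u := ustar A b0 mu theta.
have u0 : 0 < u by rewrite divr_gt0 ?subr_gt0 // mulr_gt0.
have uE : gn A * r * u = g0 A b0 - r.
  by rewrite /u /ustar /rr -/r mulrC divfK // gt_eqF // mulr_gt0.
have state0 (x : 'cV[R]_n.+1) z1 z2 :
    mk_state x z1 z2 = 0 -> [/\ x = 0, z1 = 0 & z2 = 0].
  move=> h; split.
  - by rewrite -(st_x_mk x z1 z2) h st_x_eq0.
  - by rewrite -(st_z1_mk x z1 z2) h st_z1_eq0.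
  - by rewrite -(st_z2_mk x z1 z2) h st_z2_eq0.
have sx : st_x s = - (invmx A *m (b0 - (r * u) *: en R n)) by rewrite st_x_mk.
have sz1 : st_z1 s = mu / (eta * u) by rewrite st_z1_mk.
have sz2 : st_z2 s = u / kp by rewrite st_z2_mk.
have sxn : st_x s ord_max 0 = r by rewrite sx equil_xn uE; ring.
have unz := lt0r_neq0 u0; have knz := lt0r_neq0 kp0; have enz := lt0r_neq0 eta0.
split.
- apply: state_eqP; rewrite /F /vfield st_x_mk st_z1_mk st_z2_mk sxn sx sz1 sz2.
  rewrite mulmxN mulKVmx // st_x_eq0 st_z1_eq0 st_z2_eq0; split.
  + have -> : kp * r * (u / kp) = r * u by field.
    by rewrite opprB addrAC subrK subrr.
  + by field; rewrite ?unz ?knz ?enz.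
  + by rewrite {1}mur; field; rewrite ?unz ?knz ?enz.
- move=> t /state0 [hx h1 h2].
  have tn : st_x t ord_max 0 = r.
    by apply: (mulfI (lt0r_neq0 th0)); rewrite -mur; lra.
  have tx : st_x t = - (invmx A *m (b0 - (r * (kp * st_z2 t)) *: en R n)).
    rewrite -[LHS](mulKmx uA) -mulmxN; congr (_ *m _).
    move/eqP: hx; rewrite tn -addrA addr_eq0 => /eqP ->; congr (- _).
    by rewrite addrC [kp * r]mulrC mulrA.
  have tz2 : kp * st_z2 t = u.
    move: tn; rewrite tx equil_xn => e.
    by apply: (mulfI (lt0r_neq0 (mulr_gt0 gn0 r0))); rewrite uE; lra.
  apply: state_eqP; rewrite sx sz1 sz2 tx tz2; split => //.
    have eunz := lt0r_neq0 (mulr_gt0 eta0 u0).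
    by apply: (mulfI eunz); rewrite [RHS]mulrC divfK // -tz2; lra.
  by rewrite -tz2; field.
apply/hurwitzP => al be x y al0; rewrite !vfield_jacobian /vfield_diff sxn sz1 sz2.
move=> hx hy.
pose a := eta * u; pose c := kp * mu / u; pose k := kp * r.
have a0 : 0 < a by exact: mulr_gt0.
have c0 : 0 < c by rewrite divr_gt0 // mulr_gt0.
have k0 : 0 < k by exact: mulr_gt0.
have aE (xn z2 : R) : kp * (xn * (u / kp) + r * z2) = u * xn + k * z2.
  by rewrite /k; field.
have cE (z1 z2 : R) :
    kp * eta * (z1 * (u / kp) + mu / (eta * u) * z2) = a * z1 + c * z2.
  by rewrite /a /c; field; rewrite ?unz ?knz ?enz.
rewrite !aE !cE in hx hy; rewrite -(scaleNr be y) in hx.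
have hxx := congr1 (@st_x R n) hx; have hyx := congr1 (@st_x R n) hy.
have hx1 := congr1 (@st_z1 R n) hx; have hy1 := congr1 (@st_z1 R n) hy.
have hx2 := congr1 (@st_z2 R n) hx; have hy2 := congr1 (@st_z2 R n) hy.
have xD (p q : R) v w :
    st_x (p *: v + q *: w) = p *: st_x v + q *: st_x w :> 'cV[R]_n.+1.
  by rewrite /st_x !linearD /= !linearZ.
have z1D (p q : R) v w : @st_z1 R n (p *: v + q *: w) = p * st_z1 v + q * st_z1 w.
  by rewrite /st_z1 !mxE.
have z2D (p q : R) v w : @st_z2 R n (p *: v + q *: w) = p * st_z2 v + q * st_z2 w.
  by rewrite /st_z2 !mxE.
move: hxx hyx hx1 hy1 hx2 hy2.
rewrite !(st_x_mk, st_z1_mk, st_z2_mk) !(xD, z1D, z2D) !scaleNr !mulNr.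
move=> hxx hyx hx1 hy1 hx2 hy2.
have [x0 y0 [x10 y10] [x20 y20]] := closed_loop_spectrum mA hA al0 a0 c0 u0 k0
  th0 hxx hyx hx1 hy1 hx2 hy2.
by split; apply: state_eqP; rewrite ?(x0, y0, x10, y10, x20, y20)
  st_x_eq0 st_z1_eq0 st_z2_eq0.
Qed.
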